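(* Let $p$ be a prime and let $H$ be a proper multiplicative subgroup of $\mathbb{F}_p^*$. Suppose $H=A+B$ for subsets $A,B\subseteq\mathbb{F}_p$ with $|A|,|B|\geq 2$, and write $d=|H|$, $\alpha=|A|$, $\beta=|B|$. Then $\alpha\beta=d$ and $\alpha=\beta$.
   Context: $\mathbb{F}_p$ is the finite field with $p$ elements and $\mathbb{F}_p^*=\mathbb{F}_p\setminus\{0\}$. A proper multiplicative subgroup is a subgroup $H\leq\mathbb{F}_p^*$ with $H\neq\mathbb{F}_p^*$. The sumset is $A+B=\{a+b: a\in A,\ b\in B\}$. *)

(* Defs.v *)
From HB Require Import structures.
From mathcomp Require Import all_boot all_order all_algebra all_fingroup.

Set Implicit Arguments.
Unset Strict Implicit.
Unset Printing Implicit Defensive.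

Import GRing.Theory.
Local Open Scope ring_scope.

Definition sumset (V : finZmodType) (A B : {set V}) : {set V} :=
  [set a + b | a in A, b in B].

(* Subgroups of the unit group are sets of elements of the type {unit R}; this
   is the same set viewed inside R itself, so that it can be compared with a
   sumset. *)
Definition units_in_ring (R : finUnitRingType) (H : {set {unit R}}) : {set R} :=
  [set val u | u in H].

(* Main.v *)
Require Import Defs.
From HB Require Import structures.
From mathcomp Require Import all_boot all_order all_algebra all_fingroup.
From mathcomp Require Import cyclic zify ring.

Set Implicit Arguments.
Unset Strict Implicit.
Unset Printing Implicit Defensive.

Import GRing.Theory.
Local Open Scope ring_scope.

(** Let [d = #|H|], [al = #|A|], [be = #|B|]; every sum [a + b] is a [d]-th root
    of unity, and [2 * d < p] because [H] is proper.

    The product formula comes from Stepanov's method in the form of Hanson and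
    Petridis. With the Lagrange weights [w_a = 1 / \prod_(a' != a) (a - a')] put
    [S = \sum_a w_a (X + a)^(d + al - 1) - 1]. The weights annihilate powers of
    exponent below [al - 1], so [S] has degree exactly [d]; and since
    [(a + b)^d = 1], the same fact makes every [b \in B] a root of [S] of
    multiplicity at least [al]. Hence [al * be <= d] ([card_mul_le]), while
    [d = #|A + B| <= al * be] is clear.

    Equality is rigid: [S = c \prod_b (X - b)^al]. Comparing the Taylor
    coefficients of order [al] and [al + 1] at a point [b] of both sides gives
    ([stieltjes_relation]) an analogue of the electrostatic equations for the
    zeros of orthogonal polynomials,
      [al (al + 1) \sum_(b' != b) 1 / (b - b') = (d - 1) \sum_a 1 / (a + b)],
    and the same with [A] and [B] exchanged. Multiply by [b ^ (k + 1)], sum over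
    [b], and combine with the mirror equation with the sign that turns the right
    hand sides into [(b ^ (k + 1) - (- a) ^ (k + 1)) / (a + b)]: all denominators
    disappear and a quadratic relation remains between the power sums [P_i] of
    [A] and [Q_i] of [B] ([power_sum_relation]).

    The other input is that the [k]-th power sum of [H] vanishes for
    [0 < k < d]. Translate so that [P_1 = 0]. If [P_i = Q_i = 0] for
    [0 < i < k], then [be P_k + al Q_k = 0], and the quadratic relation becomes
    [(k + 3) (al - be) be P_k = 0] for even [k] and
    [(k - 1) (al + be + 2) be P_k = 0] for odd [k] ([power_sum_step]). The
    factors other than [al - be] and [P_k] are nonzero modulo [p], so
    [al != be] would force all power sums [P_k], [0 < k < d], to vanish; but a
    set whose first [al] power sums vanish is contained in [{0}]
    ([power_sum_eq0]), against [al >= 2]. *)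

(** * Lagrange weights *)

Section Interpolation.

Variable F : finFieldType.
Implicit Types (A B : {set F}) (a b x : F) (q : {poly F}) (n d k : nat).

Definition nodal A : {poly F} := \prod_(a in A) ('X - a%:P).

(** The leading coefficient of the Lagrange polynomial equal to 1 at [a] and to
    0 on the rest of [A]. *)
Definition lagrange_weight A a : F := (\prod_(a' in A :\ a) (a - a'))^-1.

Lemma size_nodal A : size (nodal A) = #|A|.+1.
Proof. by rewrite /nodal -big_enum size_prod_XsubC cardE. Qed.

Lemma monic_nodal A : nodal A \is monic.
Proof. exact: monic_prod_XsubC. Qed.

Lemma nodal_root A a : (root (nodal A) a) = (a \in A).
Proof. by rewrite /nodal -big_enum root_prod_XsubC mem_enum. Qed.

Lemma horner_nodal A x : (nodal A).[x] = \prod_(a in A) (x - a).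
Proof. by rewrite horner_prod; apply: eq_bigr => a _; rewrite hornerXsubC. Qed.

Lemma nodalD1 A a : a \in A -> nodal A = ('X - a%:P) * nodal (A :\ a).
Proof. by move=> aA; rewrite /nodal (big_setD1 a). Qed.

Lemma eq_poly_on A q1 q2 : (size q1 <= #|A|)%N -> (size q2 <= #|A|)%N ->
  {in A, forall a, q1.[a] = q2.[a]} -> q1 = q2.
Proof.
move=> s1 s2 eq12; apply/eqP; rewrite -subr_eq0; apply/negPn/negP => nz.
have := max_poly_roots nz (rs := enum A) _ (enum_uniq _).
rewrite -cardE ltnNge => /(_ _)/negP; apply.
  apply/allP => a; rewrite mem_enum => aA.
  by rewrite rootE hornerD hornerN eq12 ?subrr.
by rewrite (leq_trans (size_polyD _ _)) // size_polyN geq_max s1 s2.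
Qed.

(** Compare the coefficients of degree [#|A| - 1] in the Lagrange interpolation
    formula, which recovers [q] from its values on [A]. *)
Lemma sum_lagrange_weight A q : (size q <= #|A|)%N ->
  \sum_(a in A) lagrange_weight A a * q.[a] = q`_(#|A|.-1).
Proof.
move=> sq.
have {2}-> : q =
    \sum_(a in A) (lagrange_weight A a * q.[a]) *: nodal (A :\ a).
  apply: (@eq_poly_on A) => // [|x xA].
    apply: (leq_trans (size_sum _ _ _)); apply/bigmax_leqP => a aA.
    by rewrite (leq_trans (size_scale_leq _ _)) // size_nodal (cardsD1 a A) aA.
  rewrite horner_sum (bigD1 x) //= big1 => [|a /andP[aA ax]]; last first.
    rewrite hornerZ [X in _ * X](_ : _ = 0) ?mulr0 //.
    by apply/eqP; rewrite -[_ == 0]/(root _ _) nodal_root !inE eq_sym ax.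
  rewrite addr0 hornerZ horner_nodal mulrAC mulVf ?mul1r //.
  rewrite prodf_seq_neq0; apply/allP => a _; rewrite !inE subr_eq0 eq_sym.
  by apply/implyP => /andP[].
rewrite coef_sum; apply: eq_bigr => a aA; rewrite coefZ.
have -> : (nodal (A :\ a))`_(#|A|.-1) = 1; last by rewrite mulr1.
have /monicP := monic_nodal (A :\ a).
by rewrite lead_coefE size_nodal (cardsD1 a A) aA.
Qed.

(** A translation changes neither the degree nor the leading coefficient. *)
Lemma sum_lagrange_weight_shift A b q : (size q <= #|A|)%N ->
  \sum_(a in A) lagrange_weight A a * q.[a + b] = q`_(#|A|.-1).
Proof.
move=> sq; have szc : size (q \Po ('X + b%:P)) = size q.
  by rewrite size_comp_poly2 // size_XaddC.
transitivity ((q \Po ('X + b%:P))`_(#|A|.-1)).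
  rewrite -sum_lagrange_weight ?szc //; apply: eq_bigr => a _.
  by rewrite horner_comp !hornerE.
have [lt | ] := ltnP (size q) #|A|.
  by rewrite !nth_default ?szc // -ltnS (ltn_predK lt).
case: #|A| sq => [|m] sq sm; first by rewrite !nth_default ?szc.
have {sq sm} eqs : size q = m.+1 by apply/eqP; rewrite eqn_leq sq.
have := lead_coef_comp q (q := 'X + b%:P); rewrite size_XaddC => /(_ isT).
by rewrite lead_coefXaddC expr1n mulr1 !lead_coefE szc eqs.
Qed.

Lemma sum_lagrange_weight_exp A b j : (j < #|A|)%N ->
  \sum_(a in A) lagrange_weight A a * (a + b) ^+ j = (j == #|A|.-1)%:R.
Proof.
move=> jA.
have := @sum_lagrange_weight_shift A b 'X^j; rewrite size_polyXn coefXn => /(_ jA).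
by rewrite [#|A|.-1 == j]eq_sym => <-; apply: eq_bigr => a _; rewrite hornerXn.
Qed.

(** The logarithmic derivative of a split polynomial, away from its roots. *)
Lemma deriv_prod_XsubC (I : Type) (r : seq I) (P : pred I) (y : I -> F) x :
    (forall i, P i -> x != y i) ->
  ((\prod_(i <- r | P i) ('X - (y i)%:P))^`()).[x] =
  (\prod_(i <- r | P i) ('X - (y i)%:P)).[x] * \sum_(i <- r | P i) (x - y i)^-1.
Proof.
move=> nz; elim: r => [|i r IHr]; first by rewrite !big_nil derivC !hornerE.
rewrite !big_cons; case: ifP => // Pi.
rewrite derivM derivXsubC !hornerE {}IHr.
have : x - y i != 0 by rewrite subr_eq0 nz.
by set u := x - _ => u0; field.
Qed.

(** Let [e] be the monic polynomial with roots [a + b], and [q] the polynomial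
    with [e = e_0 + e_1 X + X^2 q]. Since [q] has degree [#|A| - 2], its weighted
    sum vanishes; at a root [y] of [e] it takes the value
    [- e_0 / y^2 - e_1 / y], so the two weighted sums are in the ratio
    [- e_1 / e_0], a logarithmic derivative at 0. *)
Lemma sum_lagrange_weight_inv2 A b : (1 < #|A|)%N ->
    {in A, forall a, a + b != 0} ->
  \sum_(a in A) lagrange_weight A a * (a + b) ^- 2 =
  (\sum_(a in A) lagrange_weight A a * (a + b)^-1) * \sum_(a in A) (a + b)^-1.
Proof.
move=> A1 nz.
pose e : {poly F} := \prod_(a in A) ('X - (a + b)%:P).
have se : size e = #|A|.+1 by rewrite /e -big_enum size_prod_XsubC cardE.
have e0 : e.[0] != 0.
  rewrite horner_prod prodf_seq_neq0; apply/allP => a _; apply/implyP => aA.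
  by rewrite hornerXsubC sub0r oppr_eq0 nz.
have e'0 : e^`().[0] = - e.[0] * \sum_(a in A) (a + b)^-1.
  rewrite deriv_prod_XsubC => [|a aA]; last by rewrite eq_sym nz.
  rewrite mulNr -mulrN -sumrN; congr (_ * _); apply: eq_bigr => a _.
  by rewrite sub0r invrN.
pose q := drop_poly 2 e.
have sq : (size q < #|A|)%N.
  by rewrite size_drop_poly se subSS subn1 prednK // ltnW.
have := @sum_lagrange_weight_shift A b q (ltnW sq).
rewrite (@nth_default _ _ q); last by rewrite -ltnS (ltn_predK sq).
have qE y : y != 0 -> e.[y] = 0 -> q.[y] = - e.[0] * y ^- 2 - e^`().[0] * y^-1.
  move=> y0; rewrite -{1}(poly_take_drop 2 e) -/q !horner_coef0 coef_deriv.
  rewrite hornerD hornerM hornerXn.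
  rewrite (@horner_coef_wide _ 2) ?size_take_poly //.
  rewrite !big_ord_recl big_ord0 !coef_take_poly /= mulr1n addr0 mulr1 expr1.
  rewrite -addrA addrA => /eqP; rewrite addr_eq0 => /eqP E.
  have {}E : q.[y] * y ^+ 2 = - e`_0 - e`_1 * y by rewrite -opprD E opprK.
  by apply: (mulIf (expf_neq0 2 y0)); rewrite E; field.
rewrite (eq_bigr (fun a => - (e.[0] * (lagrange_weight A a * (a + b) ^- 2))
    - e^`().[0] * (lagrange_weight A a * (a + b)^-1))) => [|a aA]; last first.
  have ea : e.[a + b] = 0.
    apply/eqP; rewrite horner_prod prodf_seq_eq0; apply/hasP; exists a.
      by rewrite mem_index_enum.
    by rewrite aA hornerXsubC subrr eqxx.
  by rewrite qE ?nz //; ring.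
rewrite big_split /= !sumrN -!big_distrr /= e'0.
set S2 := \sum_(a in A) _ * _ ^- 2; set S1 := \sum_(a in A) _ * _.
set S := \sum_(a in A) _.
move=> E; apply: (mulfI e0); apply/eqP; rewrite -subr_eq0 -oppr_eq0.
by apply/eqP; rewrite -[RHS]E; ring.
Qed.

End Interpolation.

(** * The Stepanov polynomial and its rigidity *)

Section Stepanov.

Variable F : finFieldType.
Implicit Types (A B : {set F}) (a b x : F) (q : {poly F}) (n d k : nat).

Lemma natf_neq0_small p n : p \in [pchar F] -> (0 < n < p)%N -> n%:R != 0 :> F.
Proof. by move=> chF /andP[n0 np]; rewrite -(dvdn_pcharf chF) gtnNdvd. Qed.

Lemma binf_neq0_small p n k :
  p \in [pchar F] -> (k <= n < p)%N -> 'C(n, k)%:R != 0 :> F.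
Proof.
move=> chF /andP[kn np].
have nf_neq0 m : (m < p)%N -> m`!%:R != 0 :> F.
  elim: m => [|m IHm] mp; first by rewrite oner_eq0.
  by rewrite factS natrM mulf_neq0 ?IHm ?(ltnW mp) // (natf_neq0_small chF).
by have := nf_neq0 n np; rewrite -(bin_fact kn) natrM mulf_eq0 negb_or => /andP[].
Qed.

Lemma dvdp_prod_XsubC_exp (s : seq F) n q : uniq s ->
  {in s, forall b, ('X - b%:P) ^+ n %| q} -> (\prod_(b <- s) ('X - b%:P)) ^+ n %| q.
Proof.
elim: s => [|b s IHs] /=; first by rewrite big_nil expr1n dvd1p.
case/andP=> bs us dv; rewrite big_cons exprMn Gauss_dvdp.
  by rewrite dv ?mem_head // IHs // => x xs; rewrite dv // inE xs orbT.
rewrite coprimep_expl // coprimep_expr // coprimep_sym coprimep_XsubC.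
by rewrite root_prod_XsubC.
Qed.

(** Expanding around an arbitrary [b] serves twice: [b = 0] gives the degree of
    the Stepanov polynomial, [b \in B] the multiplicity of its roots. *)
Lemma exprXD_taylor a b n :
  ('X + a%:P) ^+ n =
  \sum_(i < n.+1) ('C(n, i)%:R * (a + b) ^+ (n - i)) *: ('X - b%:P) ^+ i.
Proof.
have -> : 'X + a%:P = (a + b)%:P + ('X - b%:P) by rewrite polyCD; ring.
rewrite exprDn; apply: eq_bigr => i _.
by rewrite -mul_polyC polyCM polyC_natr rmorphXn /= -mulr_natl mulrA.
Qed.

Lemma sum_scale_exp_XsubC n b (c : nat -> F)
    (q := \sum_(i < n.+2) c i *: ('X - b%:P) ^+ i) :
  q.[b] = c 0%N /\ q^`().[b] = c 1%N.
Proof.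
have hc m : (\sum_(i < m.+1) c i *: ('X - b%:P) ^+ i).[b] = c 0%N.
  rewrite big_ord_recl hornerD hornerZ expr0 hornerC mulr1 horner_sum.
  rewrite big1 ?addr0 // => i _.
  by rewrite hornerZ horner_exp hornerXsubC subrr exprS mul0r mulr0.
split; first exact: hc.
rewrite /q raddf_sum horner_sum !big_ord_recl /= big1 => [|i _];
  rewrite !derivZ !hornerE.
  rewrite /bump /= expr0 expr1 derivC derivXsubC !hornerC mulr0 mulr1.
  exact: etrans (addr0 _) (add0r _).
rewrite /bump !leq0n !add1n deriv_exp derivXsubC mul1r hornerMn horner_exp.
by rewrite hornerXsubC subrr expr0n mul0rn mulr0.
Qed.

(** The sum is the complete homogeneous symmetric polynomial of degree [d] in
    the [X + a]. *)
Definition stepanov A d : {poly F} :=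
  \sum_(a in A) lagrange_weight A a *: ('X + a%:P) ^+ (d + #|A|.-1) - 1.

Definition weighted_moment A b j : F :=
  \sum_(a in A) lagrange_weight A a * (a + b) ^+ j.

Lemma stepanov_taylor A d b (N := (d + #|A|.-1)%N) :
  stepanov A d =
  \sum_(i < N.+1) ('C(N, i)%:R * weighted_moment A b (N - i)) *: ('X - b%:P) ^+ i - 1.
Proof.
congr (_ - 1); rewrite -/N.
under eq_bigr => a _ do rewrite (exprXD_taylor a b) scaler_sumr.
rewrite exchange_big; apply: eq_bigr => i _; rewrite mulr_sumr scaler_suml.
by apply: eq_bigr => a _; rewrite scalerA mulrCA.
Qed.

(** In the expansion at 0 the coefficient of [X^i] carries the weighted moment of
    exponent [d + #|A| - 1 - i], which is 0 for [i > d] and 1 for [i = d]; the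
    remaining binomial factor is nonzero because [d + #|A| - 1 < p]. *)
Lemma size_stepanov p A d : p \in [pchar F] -> (0 < #|A|)%N -> (0 < d)%N ->
  (d + #|A|.-1 < p)%N -> size (stepanov A d) = d.+1.
Proof.
move=> chF A0 d0 Np; set N := (d + #|A|.-1)%N in Np.
pose c i := 'C(N, i)%:R * weighted_moment A 0 (N - i) - (i == 0%N)%:R.
have -> : stepanov A d = \poly_(i < d.+1) c i.
  apply/polyP => i; rewrite (stepanov_taylor A d 0) -/N coefB coef1 coef_poly.
  under eq_bigr => j _ do rewrite subr0.
  rewrite coef_sumMXn; have [iN|Ni] := boolP (i < N.+1)%N.
    rewrite (big_pred1 (Ordinal iN)) //=; case: ltnP => // di.
    rewrite /weighted_moment sum_lagrange_weight_exp; last by rewrite /N; lia.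
    have -> : (N - i == #|A|.-1)%N = false by apply/eqP; rewrite /N; lia.
    by rewrite mulr0 (_ : (i == 0%N) = false) ?subr0 //; lia.
  rewrite big1 => [|j /eqP ji]; last by move: Ni; rewrite -ji ltn_ord.
  have di : (d < i)%N by move: Ni; rewrite /N; lia.
  by rewrite ltnS leqNgt di (gtn_eqF (leq_ltn_trans (leq0n d) di)) subr0.
rewrite size_poly_eq // /c /weighted_moment /N addKn.
rewrite sum_lagrange_weight_exp ?prednK // eqxx mulr1.
by rewrite (negbTE (lt0n_neq0 d0)) subr0 (binf_neq0_small chF) // leq_addr.
Qed.

(** As [(a + b)^d = 1], the exponent [d + #|A| - 1 - i] of the [i]-th moment can
    be lowered by [d] when [i < #|A|], so that moment is 0 for [0 < i < #|A|]; for
    [i = 0] it is 1 and cancels against the constant [- 1]. *)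
Lemma stepanov_root A d b (N := (d + #|A|.-1)%N) : (0 < #|A|)%N ->
    {in A, forall a, (a + b) ^+ d = 1} ->
  stepanov A d = ('X - b%:P) ^+ #|A| *
    \sum_(i < d) ('C(N, #|A| + i)%:R * weighted_moment A b (d.-1 - i)) *:
      ('X - b%:P) ^+ i.
Proof.
move=> A0 hAb; rewrite (stepanov_taylor A d b) -/N.
have NE : (N.+1 = #|A| + d)%N by rewrite /N; lia.
rewrite NE big_split_ord /= mulr_sumr.
rewrite [X in _ + X - 1](eq_bigr (fun i : 'I_d =>
  ('X - b%:P) ^+ #|A| * (('C(N, #|A| + i)%:R *
    weighted_moment A b (d.-1 - i)) *: ('X - b%:P) ^+ i))); last first.
  move=> i _; rewrite -scalerAr -exprD (_ : (N - (#|A| + i) = d.-1 - i)%N) //.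
  by rewrite /N; lia.
rewrite addrAC [X in X + _](_ : _ = 0) ?add0r //.
apply/eqP; rewrite subr_eq0; apply/eqP.
have mE i : (i < #|A|)%N -> weighted_moment A b (N - i) = (i == 0%N)%:R.
  move=> iA.
  transitivity (weighted_moment A b (#|A|.-1 - i)).
    apply: eq_bigr => a aA.
    rewrite (_ : (N - i = d + (#|A|.-1 - i))%N); last by rewrite /N; lia.
    by rewrite exprD hAb // mul1r.
  rewrite /weighted_moment sum_lagrange_weight_exp; last by lia.
  by congr (_%:R); apply/eqP/eqP; lia.
rewrite (bigD1 (Ordinal A0)) //= mE //= bin0 mulr1 expr0 scale1r big1 ?addr0 // => i.
by move/eqP/val_eqP => /= i0; rewrite mE // (negbTE i0) mulr0 scale0r.
Qed.

Lemma stepanov_dvd A B d : (0 < #|A|)%N ->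
  {in A & B, forall a b, (a + b) ^+ d = 1} -> nodal B ^+ #|A| %| stepanov A d.
Proof.
move=> A0 hAB; rewrite /nodal -big_enum.
apply: dvdp_prod_XsubC_exp (enum_uniq _) _ => b; rewrite mem_enum => bB.
by rewrite (stepanov_root A0 (b := b)) ?dvdp_mulIl // => a aA; apply: hAB.
Qed.

Lemma size_nodal_exp B n : size (nodal B ^+ n) = (#|B| * n).+1.
Proof.
rewrite -[size _]prednK ?size_exp ?size_nodal // size_poly_gt0.
by rewrite expf_neq0 ?monic_neq0 ?monic_nodal.
Qed.

(** The bound of Hanson and Petridis: the roots of the Stepanov polynomial,
    counted with multiplicity, are at most as many as its degree. *)
Lemma card_mul_le p A B d : p \in [pchar F] -> (0 < #|A|)%N -> (0 < d)%N ->
    (d + #|A|.-1 < p)%N -> {in A & B, forall a b, (a + b) ^+ d = 1} ->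
  (#|A| * #|B| <= d)%N.
Proof.
move=> chF A0 d0 Np hAB; have sS := size_stepanov chF A0 d0 Np.
have /dvdp_leq : stepanov A d != 0 by rewrite -size_poly_eq0 sS.
by move=> /(_ _ (stepanov_dvd A0 hAB)); rewrite sS size_nodal_exp mulnC.
Qed.

Lemma stepanov_eq_nodal_exp p A B d : p \in [pchar F] -> (0 < #|A|)%N -> (0 < d)%N ->
    (d + #|A|.-1 < p)%N -> {in A & B, forall a b, (a + b) ^+ d = 1} ->
    (#|A| * #|B| = d)%N ->
  exists2 c, c != 0 & stepanov A d = c *: nodal B ^+ #|A|.
Proof.
move=> chF A0 d0 Np hAB cAB; have sS := size_stepanov chF A0 d0 Np.
have : nodal B ^+ #|A| %= stepanov A d.
  by rewrite -dvdp_size_eqp ?stepanov_dvd // sS size_nodal_exp mulnC cAB.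
rewrite eqp_sym => /eqp_eq; rewrite (monicP (monic_exp _ (monic_nodal B))) scale1r => E.
by exists (lead_coef (stepanov A d)); rewrite // lead_coef_eq0 -size_poly_eq0 sS.
Qed.

(** Divide [stepanov A d = c *: nodal B ^+ #|A|] by [('X - b%:P) ^+ #|A|] and take
    the logarithmic derivative at [b]. On the right it is
    [#|A| * \sum_(b' != b) 1 / (b - b')]; on the left it is the quotient of the
    Taylor coefficients of order [#|A| + 1] and [#|A|], whose moments have the
    exponents [d - 2] and [d - 1], that is [-2] and [-1]. *)
Lemma stieltjes_relation p A B d b :
    p \in [pchar F] -> (1 < #|A|)%N -> (1 < d)%N ->
    (d + #|A|.-1 < p)%N -> {in A & B, forall a b, (a + b) ^+ d = 1} ->
    (#|A| * #|B| = d)%N -> b \in B ->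
  #|A|%:R * #|A|.+1%:R * \sum_(b' in B :\ b) (b - b')^-1 =
  d.-1%:R * \sum_(a in A) (a + b)^-1 :> F.
Proof.
move=> chF A1 d1 Np hAB cAB bB; have A0 := ltnW A1; have d0 := ltnW d1.
have hAb : {in A, forall a, (a + b) ^+ d = 1} by move=> a aA; apply: hAB.
have [c c0] := stepanov_eq_nodal_exp chF A0 d0 Np hAB cAB.
rewrite (stepanov_root A0 hAb) (nodalD1 bB) exprMn scalerAr.
set W := \sum_(i < d) _; have X0 : ('X - b%:P) ^+ #|A| != 0.
  by rewrite expf_neq0 // polyXsubC_eq0.
move=> /(mulfI X0) WE {X0}.
set Sb := \sum_(b' in _) _; set Sa := \sum_(a in A) _.
have gb0 : (nodal (B :\ b)).[b] != 0.
  by rewrite -[_ == 0]/(root _ _) nodal_root !inE eqxx.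
have Wb0 : W.[b] != 0 by rewrite WE hornerZ horner_exp mulf_neq0 ?expf_neq0.
have g'b : (nodal (B :\ b))^`().[b] = (nodal (B :\ b)).[b] * Sb.
  by apply: deriv_prod_XsubC => b'; rewrite !inE eq_sym => /andP[].
have W'b : W^`().[b] = #|A|%:R * Sb * W.[b].
  rewrite WE derivZ deriv_exp !hornerZ hornerMn hornerM !horner_exp g'b.
  by rewrite -[X in _ = _ * (_ * _ ^+ X)](prednK A0) exprS -mulr_natl; ring.
have aD0 : {in A, forall a, a + b != 0}.
  move=> a aA; apply/eqP => a0; have := hAb a aA.
  by rewrite a0 expr0n gtn_eqF // => /eqP; rewrite eq_sym oner_eq0.
pose M := weighted_moment A b.
have M1 : M d.-1 = \sum_(a in A) lagrange_weight A a * (a + b)^-1.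
  apply: eq_bigr => a aA; congr (_ * _); apply: (mulfI (aD0 a aA)).
  by rewrite -exprS prednK // hAb // divff // aD0.
have M2 : M d.-2 = M d.-1 * Sa.
  rewrite M1 -(sum_lagrange_weight_inv2 A1 aD0).
  apply: eq_bigr => a aA; congr (_ * _); apply: (mulfI (expf_neq0 2 (aD0 a aA))).
  by rewrite -exprD (_ : (2 + d.-2 = d)%N) ?hAb ?divff ?expf_neq0 ?aD0 //; lia.
set N := (d + #|A|.-1)%N in W WE Wb0 W'b Np.
have [Wb W'b'] : W.[b] = 'C(N, #|A|)%:R * M d.-1 /\
    W^`().[b] = 'C(N, #|A|.+1)%:R * M d.-2.
  have := sum_scale_exp_XsubC d.-2 b (fun i => 'C(N, #|A| + i)%:R * M (d.-1 - i)%N).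
  by rewrite (_ : d.-2.+2 = d) -/W ?addn0 ?subn0 ?addn1 ?subn1 //; lia.
have binE : #|A|.+1%:R * 'C(N, #|A|.+1)%:R = d.-1%:R * 'C(N, #|A|)%:R :> F.
  rewrite -!natrM mul_bin_left (_ : (N - #|A| = d.-1)%N) // /N; lia.
apply: (mulIf Wb0); rewrite [in RHS]Wb.
transitivity (#|A|.+1%:R * W^`().[b]); first by rewrite W'b; ring.
by rewrite W'b' M2 !mulrA binE; ring.
Qed.

End Stepanov.

(** * Power sums *)

Section PowerSums.

Variable F : finFieldType.
Implicit Types (A B : {set F}) (a b x : F) (n d k : nat).

Definition power_sum A k : F := \sum_(a in A) a ^+ k.

Lemma power_sum0 A : power_sum A 0 = #|A|%:R.
Proof. by rewrite /power_sum; under eq_bigr do rewrite expr0; rewrite sumr_const. Qed.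

(** If [x \in A] were nonzero, [nodal (A :\ x) * 'X] would have no constant term
    and be nonzero on [A] only at [x]; but its sum over [A] is a combination of
    the vanishing power sums. *)
Lemma power_sum_eq0 A :
  (forall k, (0 < k <= #|A|)%N -> power_sum A k = 0) -> A \subset [set 0].
Proof.
move=> P0; apply/subsetP => x xA; rewrite inE; apply/eqP.
pose q := nodal (A :\ x) * 'X.
have sq : (size q <= #|A|.+1)%N.
  by rewrite size_mulX ?monic_neq0 ?monic_nodal // size_nodal (cardsD1 x A) xA.
have q0 : \sum_(a in A) q.[a] = 0.
  under eq_bigr => a _ do rewrite (horner_coef_wide a sq).
  rewrite exchange_big big1 //= => i _; rewrite -mulr_sumr.
  have [->|i0] := posnP i; first by rewrite coefMX mul0r.
  by rewrite [X in _ * X](_ : _ = 0) ?mulr0 //; apply: P0; rewrite i0 -ltnS ltn_ord.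
move: q0; rewrite (bigD1 x) //= big1 => [|a /andP[aA ax]]; last first.
  rewrite hornerM [X in X * _](_ : _ = 0) ?mul0r //.
  by apply/eqP; rewrite -[_ == 0]/(root _ _) nodal_root !inE ax.
rewrite addr0 hornerM hornerX => /eqP; rewrite mulf_eq0 => /orP[|/eqP //].
by rewrite -[_ == 0]/(root _ _) nodal_root !inE eqxx.
Qed.

(** Adding the terms of the pairs [(b, b')] and [(b', b)] produces
    [(b ^+ k.+1 - b' ^+ k.+1) / (b - b')], a geometric sum; completing the sum to
    all pairs adds the diagonal, where the geometric sum is [k.+1 * b ^+ k]. *)
Lemma sum_inv_diff_moment B k :
  2%:R * (\sum_(b in B) b ^+ k.+1 * \sum_(b' in B :\ b) (b - b')^-1) =
  \sum_(i < k.+1) power_sum B (k - i) * power_sum B i - k.+1%:R * power_sum B k.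
Proof.
(* With [0^-1 = 0] the diagonal terms vanish, so both indices may range over [B]. *)
pose G b b' : F := b ^+ k.+1 * (b - b')^-1.
have -> : \sum_(b in B) b ^+ k.+1 * (\sum_(b' in B :\ b) (b - b')^-1) =
          \sum_(b in B) \sum_(b' in B) G b b'.
  apply: eq_bigr => b bB; rewrite mulr_sumr [RHS](big_setD1 b) //=.
  by rewrite /G subrr invr0 mulr0 add0r.
rewrite mulr_natl mulr2n [X in X + _]exchange_big -big_split /=.
have GE b b' : G b' b + G b b' =
    \sum_(i < k.+1) b ^+ (k - i) * b' ^+ i - (b' == b)%:R * (k.+1%:R * b ^+ k).
  have [->|ne] := eqVneq b' b.
    rewrite /G subrr invr0 mulr0 addr0 mul1r (eq_bigr (fun=> b ^+ k)) => [|i _].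
      by rewrite sumr_const card_ord mulr_natl subrr.
    by rewrite -exprD subnK // -ltnS ltn_ord.
  have nz : b - b' != 0 by rewrite subr_eq0 eq_sym.
  rewrite mul0r subr0 /G -opprB invrN mulrN addrC -mulrBl subrXX /=.
  by rewrite mulrAC divff ?mul1r.
rewrite (eq_bigr (fun b =>
  \sum_(i < k.+1) b ^+ (k - i) * power_sum B i - k.+1%:R * b ^+ k)).
  rewrite big_split /= sumrN -mulr_sumr exchange_big /=; congr (_ - _).
  by apply: eq_bigr => i _; rewrite -mulr_suml.
move=> b bB; rewrite -big_split (eq_bigr _ (fun b' _ => GE b b')).
rewrite big_split /= sumrN; congr (_ - _).
  by rewrite exchange_big; apply: eq_bigr => i _; rewrite -mulr_sumr.
rewrite (bigD1 b) //= eqxx mul1r big1 ?addr0 // => b' /andP[_ /negbTE->].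
by rewrite mul0r.
Qed.

(** The sign makes the two terms of a pair combine into
    [(b ^+ k.+1 - (- a) ^+ k.+1) / (b - (- a))], again a geometric sum. *)
Lemma sum_inv_add_moment A B k : {in A & B, forall a b, a + b != 0} ->
  \sum_(b in B) b ^+ k.+1 * (\sum_(a in A) (a + b)^-1) +
    (-1) ^+ k * \sum_(a in A) a ^+ k.+1 * (\sum_(b in B) (b + a)^-1) =
  \sum_(i < k.+1) (-1) ^+ i * (power_sum B (k - i) * power_sum A i).
Proof.
move=> nz; rewrite mulr_sumr.
under eq_bigr => b _ do rewrite mulr_sumr.
under [X in _ + X]eq_bigr => a _ do rewrite mulrA mulr_sumr.
rewrite [X in _ + X]exchange_big -big_split /=.
under eq_bigr => b _ do rewrite -big_split /=.
transitivity (\sum_(b in B) \sum_(a in A)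
  \sum_(i < k.+1) (-1) ^+ i * (b ^+ (k - i) * a ^+ i)).
  apply: eq_bigr => b bB; apply: eq_bigr => a aA.
  have ab0 : a + b != 0 by rewrite nz.
  have := subrXX b (- a) k.+1.
  rewrite /= opprK (exprNn a k.+1) (exprS (-1)) [b + a]addrC => E.
  rewrite -mulrDl; apply: (mulIf ab0); rewrite divfK // [RHS]mulrC.
  rewrite (eq_bigr (fun i : 'I_k.+1 => b ^+ (k - i) * (- a) ^+ i)) => [|i _].
    by rewrite -E; ring.
  by rewrite [(- a) ^+ i]exprNn mulrCA.
transitivity (\sum_(b in B) \sum_(i < k.+1)
  (-1) ^+ i * (b ^+ (k - i) * power_sum A i)).
  apply: eq_bigr => b _; rewrite exchange_big; apply: eq_bigr => i _.
  by rewrite -!mulr_sumr.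
rewrite exchange_big; apply: eq_bigr => i _.
by rewrite -mulr_sumr -mulr_suml.
Qed.

Lemma sum_add_moment A B k :
  \sum_(a in A) \sum_(b in B) (a + b) ^+ k =
  \sum_(i < k.+1) 'C(k, i)%:R * (power_sum A (k - i) * power_sum B i).
Proof.
transitivity (\sum_(a in A) \sum_(i < k.+1)
  'C(k, i)%:R * (a ^+ (k - i) * power_sum B i)).
  apply: eq_bigr => a _; under eq_bigr => b _ do rewrite exprDn.
  rewrite exchange_big; apply: eq_bigr => i _.
  by rewrite !mulr_sumr; apply: eq_bigr => b _; rewrite mulr_natl.
rewrite exchange_big; apply: eq_bigr => i _.
by rewrite -mulr_sumr -mulr_suml.
Qed.

Lemma sum_ord_ends (f : nat -> F) k : (0 < k)%N ->
  (forall i, (0 < i < k)%N -> f i = 0) -> \sum_(i < k.+1) f i = f 0%N + f k.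
Proof.
case: k => // k _ f0; rewrite big_ord_recl big_ord_recr /= big1 => [|i _].
  by rewrite /bump leq0n add1n; congr (_ + _); apply: add0r.
by rewrite f0 // /bump leq0n add1n; apply: (ltn_ord i).
Qed.

Lemma natf_inj_small p m n : p \in [pchar F] -> (m < p)%N -> (n < p)%N ->
  m%:R = n%:R :> F -> m = n.
Proof.
move=> chF; wlog le_nm : m n / (n <= m)%N => [W mp np E|mp np E].
  have [le|/ltnW le] := leqP n m; [exact: W | exact/esym/W].
apply/eqP; rewrite eqn_leq le_nm andbT leqNgt; apply/negP => lt_nm.
have /negP[] : (m - n)%:R != 0 :> F by apply: (natf_neq0_small chF); lia.
by rewrite natrB // E subrr.
Qed.

(** The Stieltjes relations of all [b \in B] and all [a \in A], with weights
    [b ^+ k.+1] and [(-1) ^+ k * a ^+ k.+1]. Combined with [sum_inv_diff_moment]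
    it involves power sums only. *)
Lemma power_sum_relation p A B d k :
    p \in [pchar F] -> (1 < #|A|)%N -> (1 < #|B|)%N ->
    (#|A| * #|B| = d)%N -> (2 * d < p)%N ->
    {in A & B, forall a b, (a + b) ^+ d = 1} ->
  #|A|%:R * #|A|.+1%:R * (\sum_(b in B) b ^+ k.+1 * \sum_(b' in B :\ b) (b - b')^-1) +
  (-1) ^+ k * (#|B|%:R * #|B|.+1%:R *
     (\sum_(a in A) a ^+ k.+1 * \sum_(a' in A :\ a) (a - a')^-1)) =
  d.-1%:R * \sum_(i < k.+1) (-1) ^+ i * (power_sum B (k - i) * power_sum A i).
Proof.
move=> chF A1 B1 cAB dp hAB.
have [d1 dA dB] :
    [/\ (1 < d)%N, (d + #|A|.-1 < p)%N & (d + #|B|.-1 < p)%N] by split; nia.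
have hBA : {in B & A, forall b a, (b + a) ^+ d = 1}.
  by move=> b a bB aA; rewrite addrC hAB.
have relB b : b \in B -> _ := stieltjes_relation chF A1 d1 dA hAB cAB.
have cBA : (#|B| * #|A| = d)%N by rewrite mulnC.
have relA a : a \in A -> _ := stieltjes_relation chF B1 d1 dB hBA cBA.
rewrite -sum_inv_add_moment => [|a b aA bB]; last first.
  apply/eqP => ab0; have := hAB a b aA bB.
  by rewrite ab0 expr0n gtn_eqF ?(ltnW d1) // => /eqP; rewrite eq_sym oner_eq0.
rewrite mulrDr [X in _ = _ + X]mulrCA; congr (_ + _ * _).
  by rewrite !mulr_sumr; apply: eq_bigr => b bB; rewrite mulrCA relB // mulrCA.
by rewrite !mulr_sumr; apply: eq_bigr => a aA; rewrite mulrCA relA // mulrCA.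
Qed.

End PowerSums.

(** * Equality of the cardinals *)

Section EqualCardinals.

Variable F : finFieldType.
Implicit Types (A B : {set F}) (a b x : F) (n d k : nat).

(** Once the lower power sums vanish, only the two extreme terms survive on each
    side of [power_sum_relation], and [#|A| * Q_k = - (#|B| * P_k)] leaves a
    multiple of [#|B| * P_k]. Its numerical factor is
    [(k + 3) * (#|A| - #|B|)] for even [k] and [(k - 1) * (#|A| + #|B| + 2)] for
    odd [k]; for [k = 1] it is 0, whence the hypothesis [1 < k]. *)
Lemma power_sum_step p A B d k :
    p \in [pchar F] -> (1 < #|A|)%N -> (1 < #|B|)%N ->
    (#|A| * #|B| = d)%N -> (2 * d < p)%N -> (1 < k < d)%N ->
    {in A & B, forall a b, (a + b) ^+ d = 1} ->
    (forall i, (0 < i < k)%N -> power_sum A i = 0 /\ power_sum B i = 0) ->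
    #|B|%:R * power_sum A k + #|A|%:R * power_sum B k = 0 ->
  #|A| != #|B| -> power_sum A k = 0.
Proof.
move=> chF A1 B1 cAB dp /andP[k1 kd] hAB PQ0 PQk neAB.
have k0 : (0 < k)%N by apply: ltnW.
pose TB := \sum_(b in B) b ^+ k.+1 * \sum_(b' in B :\ b) (b - b')^-1.
pose TA := \sum_(a in A) a ^+ k.+1 * \sum_(a' in A :\ a) (a - a')^-1.
have rel := power_sum_relation k chF A1 B1 cAB dp hAB; rewrite -/TA -/TB in rel.
rewrite (sum_ord_ends k0 (f := fun i =>
  (-1) ^+ i * (power_sum B (k - i) * power_sum A i))) in rel; last first.
  by move=> i ik; rewrite (PQ0 i ik).1 !mulr0.
have TAE : 2%:R * TA = 2%:R * (#|A|%:R * power_sum A k) - k.+1%:R * power_sum A k.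
  rewrite sum_inv_diff_moment; congr (_ - _).
  rewrite (sum_ord_ends k0 (f := fun i => power_sum A (k - i) * power_sum A i)).
    by rewrite subn0 subnn power_sum0; ring.
  by move=> i ik; rewrite (PQ0 i ik).1 mulr0.
have TBE : 2%:R * TB = 2%:R * (#|B|%:R * power_sum B k) - k.+1%:R * power_sum B k.
  rewrite sum_inv_diff_moment; congr (_ - _).
  rewrite (sum_ord_ends k0 (f := fun i => power_sum B (k - i) * power_sum B i)).
    by rewrite subn0 subnn power_sum0; ring.
  by move=> i ik; rewrite (PQ0 i ik).2 mulr0.
rewrite subn0 subnn !power_sum0 expr0 mul1r in rel.
have dE : d.-1%:R = #|A|%:R * #|B|%:R - 1 :> F.
  by rewrite -natrM cAB -subn1 natrB //; lia.
move: rel TAE TBE PQk; rewrite dE -[#|A|.+1]addn1 -[#|B|.+1]addn1 -[k.+1]addn1 !natrD.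
have a0 : #|A|%:R != 0 :> F by apply: (natf_neq0_small chF); nia.
have b0 : #|B|%:R != 0 :> F by apply: (natf_neq0_small chF); nia.
have ab0 : #|A|%:R - #|B|%:R != 0 :> F.
  by rewrite subr_eq0; apply: contra neAB => /eqP/(natf_inj_small chF)->//; nia.
have k3 : k%:R + 3%:R != 0 :> F by rewrite -natrD; apply: (natf_neq0_small chF); nia.
have km1 : k%:R - 1 != 0 :> F.
  by rewrite -(natrB _ k0); apply: (natf_neq0_small chF); lia.
have s2 : #|A|%:R + #|B|%:R + 2%:R != 0 :> F.
  by rewrite -!natrD; apply: (natf_neq0_small chF); nia.
move: a0 b0 ab0 k3 km1 s2; move: (#|A|%:R) (#|B|%:R) (k%:R) => u v c.
move: TA TB (power_sum A k) (power_sum B k) => S T P Q u0 v0 uv0 k3 km1 s2 rel SE TE PQk.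
have QE : u * Q = - (v * P) by apply/eqP; rewrite -addr_eq0 addrC; apply/eqP.
have {}rel : u * (u + 1) * (2%:R * T) + (-1) ^+ k * (v * (v + 1) * (2%:R * S)) -
    2%:R * ((u * v - 1) * (u * Q + (-1) ^+ k * (v * P))) = 0.
  transitivity (2%:R * (u * (u + 1) * T + (-1) ^+ k * (v * (v + 1) * S)) -
    2%:R * ((u * v - 1) * (u * Q + (-1) ^+ k * (v * P)))); first by ring.
  by rewrite rel [Q * u]mulrC subrr.
rewrite SE TE in rel.
have {}rel : (u + 1) * (2%:R * v - (c + 1)) * (u * Q) +
    (-1) ^+ k * ((v + 1) * (2%:R * u - (c + 1)) * (v * P)) -
    2%:R * ((u * v - 1) * (u * Q + (-1) ^+ k * (v * P))) = 0 by rewrite -[RHS]rel; ring.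
rewrite QE -signr_odd in rel.
have : v * P = 0; last by move/eqP; rewrite mulf_eq0 (negbTE v0) => /eqP.
case: (odd k) rel; rewrite ?expr0 ?expr1 => rel.
  apply: (mulfI (mulf_neq0 km1 s2)); rewrite mulr0 -[RHS]rel; ring.
apply: (mulfI (mulf_neq0 k3 uv0)); rewrite mulr0 -[RHS]rel; ring.
Qed.

(** The vanishing moments [hS] of [A + B] propagate the vanishing of the power
    sums of [A] to those of [B], and [power_sum_step] goes from one exponent to
    the next; the induction would reach exponent [#|A|], which is smaller than
    [d]. *)
Lemma eq_card_centred p A B d :
    p \in [pchar F] -> (1 < #|A|)%N -> (1 < #|B|)%N ->
    (#|A| * #|B| = d)%N -> (2 * d < p)%N ->
    {in A & B, forall a b, (a + b) ^+ d = 1} ->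
    (forall k, (0 < k < d)%N -> \sum_(a in A) \sum_(b in B) (a + b) ^+ k = 0) ->
  power_sum A 1 = 0 -> #|A| = #|B|.
Proof.
move=> chF A1 B1 cAB dp hAB hS P1; apply/eqP/negPn/negP => neAB.
have a0 : #|A|%:R != 0 :> F by apply: (natf_neq0_small chF); nia.
suff PQ0 k : (0 < k < d)%N -> power_sum A k = 0 /\ power_sum B k = 0.
  have A0 : A \subset [set 0].
    by apply: power_sum_eq0 => k /andP[k0 kA]; apply: (PQ0 k _).1; nia.
  by have := subset_leq_card A0; rewrite cards1 leqNgt A1.
elim/ltn_ind: k => k IHk kd; have /andP[k0 _] := kd.
have low i : (0 < i < k)%N -> power_sum A i = 0 /\ power_sum B i = 0.
  by move=> ik; apply: IHk; lia.
have PQk : #|B|%:R * power_sum A k + #|A|%:R * power_sum B k = 0.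
  rewrite -(hS k kd) sum_add_moment.
  rewrite (sum_ord_ends k0 (f := fun i =>
    'C(k, i)%:R * (power_sum A (k - i) * power_sum B i))).
    by rewrite subn0 subnn !power_sum0 bin0 binn; ring.
  by move=> i ik; rewrite (low i ik).2 !mulr0.
have Pk : power_sum A k = 0.
  have [->//|k1] := eqVneq k 1%N.
  by apply: (power_sum_step chF A1 B1 cAB dp _ hAB low PQk neAB); lia.
split=> //; move/eqP: PQk; rewrite Pk mulr0 add0r mulf_eq0 (negbTE a0).
by move/eqP.
Qed.

(** The translations of [A] by [t] and of [B] by [- t] preserve all sums [a + b],
    and [#|A|] is invertible, so the first power sum of [A] may be assumed to
    vanish. *)
Lemma eq_card_roots_of_unity p A B d :
    p \in [pchar F] -> (1 < #|A|)%N -> (1 < #|B|)%N ->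
    (#|A| * #|B| = d)%N -> (2 * d < p)%N ->
    {in A & B, forall a b, (a + b) ^+ d = 1} ->
    (forall k, (0 < k < d)%N -> \sum_(a in A) \sum_(b in B) (a + b) ^+ k = 0) ->
  #|A| = #|B|.
Proof.
move=> chF A1 B1 cAB dp hAB hS.
have a0 : #|A|%:R != 0 :> F by apply: (natf_neq0_small chF); nia.
pose t := - (power_sum A 1 / #|A|%:R).
pose A' := [set a + t | a in A]; pose B' := [set b - t | b in B].
have cA : #|A'| = #|A| by apply/card_imset/addIr.
have cB : #|B'| = #|B| by apply/card_imset/addIr.
rewrite -cA -cB; apply: (@eq_card_centred p A' B' d); rewrite ?cA ?cB //.
- move=> _ _ /imsetP[a aA ->] /imsetP[b bB ->].
  by rewrite addrACA subrr addr0 hAB.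
- move=> k kd; rewrite -[RHS](hS k kd) big_imset /=; last by move=> ? ? _ _; apply: addIr.
  apply: eq_bigr => a _; rewrite big_imset /=; last by move=> ? ? _ _; apply: addIr.
  by apply: eq_bigr => b _; rewrite addrACA subrr addr0.
rewrite /power_sum big_imset /=; last by move=> ? ? _ _; apply: addIr.
rewrite big_split /= sumr_const -mulr_natr mulNr divfK //.
exact: subrr.
Qed.

(** A polynomial [X^k - 1] with [k < #|H|] does not vanish on all of [H], and
    multiplication by an element [h] with [h ^+ k != 1] permutes [H]. *)
Lemma sum_group_exp (H : {group {unit F}}) k : (0 < k < #|H|)%N ->
  \sum_(u in H) val u ^+ k = 0 :> F.
Proof.
case/andP=> k0 kH.
have [h hH hk] : exists2 h, h \in H & val h ^+ k != 1.
  apply/exists_inP; rewrite -[[exists _ in _, _]]negbK negb_exists_in.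
  apply/negP => /forall_inP h1.
  have nz : 'X^k - 1 != 0 :> {poly F} by rewrite -size_poly_eq0 size_XnsubC.
  have /(_ _)/(_ _) := max_poly_roots nz (rs := map val (enum H)).
  rewrite size_XnsubC // size_map -cardE ltnS leqNgt kH => W.
  suff: false by [].
  apply: W; last by rewrite map_inj_uniq ?enum_uniq //; apply: val_inj.
  apply/allP => _ /mapP[u uH ->]; rewrite mem_enum in uH.
  by rewrite rootE !hornerE subr_eq0 -[_ == _]negbK h1.
apply/eqP; have : (val h ^+ k - 1) * (\sum_(u in H) val u ^+ k) == 0.
  rewrite mulrBl mul1r subr_eq0 mulr_sumr; apply/eqP.
  rewrite [RHS](reindex_inj (mulgI h)) /=; apply: eq_big => [u|u _].
    by rewrite groupMl.
  by rewrite -exprMn.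
by rewrite mulf_eq0 subr_eq0 (negbTE hk).
Qed.

End EqualCardinals.

Local Close Scope ring_scope.

Theorem theorem1p2 (p : nat) (hp : prime p)
    (H : {group {unit 'F_p}}) (hH : H \proper [set: {unit 'F_p}])
    (A B : {set 'F_p}) (hA : 2 <= #|A|) (hB : 2 <= #|B|)
    (hAB : units_in_ring H = sumset A B) :
  #|A| * #|B| = #|H| /\ #|A| = #|B|.
Proof.
have chF : p \in [pchar 'F_p]%R by apply: pchar_Fp.
have dp : (2 * #|H| < p)%N.
  have := cardSg (subsetT H); rewrite card_finField_unit card_Fp //.
  have := proper_card hH; rewrite card_finField_unit card_Fp // => lt /dvdnP[m E].
  have p0 := prime_gt0 hp.
  move: lt E; move: #|H| => h lt E.
  case: m E => [|[|m]] E; nia.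
have cS : #|sumset A B| = #|H| by rewrite -hAB card_imset //; apply: val_inj.
have roots : {in A & B, forall a b, (a + b) ^+ #|H| = 1}%R.
  move=> a b aA bB; have : (a + b)%R \in units_in_ring H by rewrite hAB imset2_f.
  by case/imsetP=> u uH ->; rewrite -FinRing.val_unitX expg_cardG.
have leA : (#|A| <= #|H|)%N.
  have [b bB] : exists b, b \in B by apply/card_gt0P; apply: ltnW.
  rewrite -cS -(card_imset (mem A) (addIr b)); apply/subset_leq_card/subsetP.
  by move=> _ /imsetP[a aA ->]; apply: imset2_f.
have cAB : (#|A| * #|B| = #|H|)%N.
  apply/eqP; rewrite eqn_leq (card_mul_le chF _ _ _ roots) ?cardG_gt0 ?(ltnW hA) //=; last first.
    by move: leA dp hA; move: #|A| #|H| => m n; lia.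
  by rewrite -cS -cardsX /sumset curry_imset2X leq_imset_card.
split=> //; apply: (eq_card_roots_of_unity chF hA hB cAB dp roots) => k kd.
rewrite -[RHS](sum_group_exp kd) -[RHS](big_imset (fun x => x ^+ k)%R); last first.
  by move=> ? ? _ _; apply: val_inj.
(* Since [#|A + B| = #|A| * #|B|], each element of [H] is a sum in one way. *)
rewrite -/(units_in_ring H) hAB /sumset curry_imset2X big_imset /=; last first.
  by apply/imset_injP; rewrite -curry_imset2X -/(sumset A B) cS cardsX cAB.
by rewrite pair_big; apply: eq_big => -[a b]; rewrite ?inE.
Qed.
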